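(* Let $n\ge 2$ and $\mathcal{F}=\mathrm{RG}_{\mathrm{nc}}(n,k)$ for some $1\le k\le n$. Under the action of $\mathbf{w}$ on $\mathcal{F}$, the statistic $I_{2\mapsto 1}-I_{n\mapsto 1}$ is $0$-mesic; that is, for every $\mathbf{w}$-orbit $O\subseteq\mathcal{F}$, $$\frac{1}{\#O}\sum_{f\in O}\bigl(I_{2\mapsto 1}(f)-I_{n\mapsto 1}(f)\bigr)=0.$$
   Context: Notation: $[n]=\{1,\dots,n\}$. Given a set partition of $[n]$ with $k$ blocks, order the blocks by increasing least element; its restricted growth word (RG-word) is the function $f:[n]\to[k]$ with $f(i)=j$ if $i$ is in the $j$-th block. A partition of $[n]$ is noncrossing if there are no $a<b<c<d$ in $[n]$ with $a,c$ in one block and $b,d$ in another block. $\mathrm{RG}_{\mathrm{nc}}(n,k)$ is the set of RG-words of noncrossing partitions of $[n]$ into exactly $k$ blocks, regarded as functions $[n]\to[k]$. Whirling: for a family $\mathcal{F}$ of functions $[n]\to[k]$ and $i\in[n]$, the map $w_i:\mathcal{F}\to\mathcal{F}$ sends $f$ to the function obtained by repeatedly adding $1$ modulo $k$ to the value of $f$ at $i$ (residues represented in $[k]$, all other values unchanged, at least one addition performed), stopping the first time the resulting function is in $\mathcal{F}$. Each $w_i$ is a bijection. $\mathbf{w}=w_n\circ\cdots\circ w_2\circ w_1$ (so $w_1$ is applied first). $I_{i\mapsto 1}(f)=1$ if $f(i)=1$ and $I_{i\mapsto 1}(f)=0$ otherwise. A statistic is $c$-mesic under an invertible map with finite orbits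 if its average over every orbit equals $c$. *)

(* Defs.v *)
From HB Require Import structures.
From mathcomp Require Import all_boot all_order all_algebra.

Set Implicit Arguments.
Unset Strict Implicit.
Unset Printing Implicit Defensive.

(* [n] and [k] are represented by 'I_n and 'I_k, so every label is shifted    *)
(* down by one: position i and value j of the paper are the ordinals with     *)
(* values i - 1 and j - 1. Blocks are likewise ranked from 0.                 *)

Section NoncrossingPartitions.

Variable n : nat.
Implicit Types (A B C : {set 'I_n}) (P : {set {set 'I_n}}).

Definition noncrossing P : bool :=
  [forall B in P, forall C in P, (B != C) ==>
     ~~ [exists a in B, exists b in C, exists c in B, exists d in C,
           [&& a < b, b < c & c < d]]].

Definition least B : nat := \big[minn/n]_(i in B) (i : nat).

Definition blocks P : seq {set 'I_n} :=
  sort (fun A B => least A <= least B) (enum P).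

Definition rg_word P (i : 'I_n) : nat := index (pblock P i) (blocks P).

End NoncrossingPartitions.

Definition RGnc (n k : nat) : {set {ffun 'I_n -> 'I_k}} :=
  [set f : {ffun 'I_n -> 'I_k} | [exists P : {set {set 'I_n}},
     [&& partition P [set: 'I_n], #|P| == k, noncrossing P &
         [forall i, (f i : nat) == rg_word P i]]]].

Section Whirling.

Variables n k : nat.
Implicit Types (F : {set {ffun 'I_n -> 'I_k}}) (f : {ffun 'I_n -> 'I_k}).

Definition incr_at (i : 'I_n) f : {ffun 'I_n -> 'I_k} :=
  [ffun j => if j == i then ordS (f j) else f j].

(* The candidates are the results of 1, 2, ..., k successive increments. The  *)
(* k-th one is f itself, so the default of head is irrelevant when f \in F.   *)
Definition whirl_at F (i : 'I_n) f : {ffun 'I_n -> 'I_k} :=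
  head f [seq g <- traject (incr_at i) (incr_at i f) k | g \in F].

(* enum 'I_n is increasing, so the first position is whirled first. *)
Definition whirl F f : {ffun 'I_n -> 'I_k} :=
  foldl (fun g i => whirl_at F i g) f (enum 'I_n).

Definition indic1 (i : 'I_n) f : rat := ((f i : nat) == 0)%:R%R.

End Whirling.

(* orbit w x is the duplicate-free forward orbit of x; it is the full orbit   *)
(* when w restricts to a bijection of the finite set F.                       *)
Definition mesic (T : finType) (F : {set T}) (w : T -> T)
    (stat : T -> rat) (c : rat) : Prop :=
  forall x : T, x \in F ->
    ((size (orbit w x))%:R^-1 * \sum_(y <- orbit w x) stat y = c)%R.

Definition pos_second (n : nat) (hn : 2 <= n) : 'I_n := Ordinal hn.

Definition pos_last (n : nat) (hn : 2 <= n) : 'I_n :=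
  rev_ord (Ordinal (ltnW hn)).

(* Main.v *)
(* Extend every word by a last letter f(n+1) = 1. If w_i turns f into g, then
   f(i) = f(i-1) holds if and only if g(i+1) = g(i): when f(i) repeats f(i-1),
   the noncrossing condition rules out every value cyclically between f(i) and
   f(i+1), while f(i+1) itself is admissible; conversely, the value f(i-1)
   would be admissible and reached before f(i+1). Chaining these equivalences
   for i = 2, ..., n shows that f(2) = 1 if and only if (w f)(n) = 1, so the
   two indicators have the same sum over each orbit. *)

Require Import Defs.
From mathcomp Require Import all_boot all_order all_algebra.
From mathcomp Require Import zify.

Set Implicit Arguments.
Unset Strict Implicit.
Unset Printing Implicit Defensive.

(** * Noncrossing restricted growth words and changes of one letter *)

(** Positions range over all of [nat], with only the first [N] letters constrained, so that
    neighbours and an appended letter need no ordinal casts. *)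
Record nc_word (N k : nat) (h : nat -> nat) : Prop := NcWord {
  nc_word_lt : forall j, j < N -> h j < k;
  nc_word_surj : forall v, v < k -> exists2 i, i < N & h i = v;
  nc_word_growth : forall j v, j < N -> v < h j -> exists2 i, i < j & h i = v;
  nc_word_nc : forall a b c d, a < b -> b < c -> c < d -> d < N ->
    h a = h c -> h b = h d -> h a = h b }.

Definition upd (h : nat -> nat) (i x : nat) : nat -> nat :=
  fun j => if j == i then x else h j.

Lemma upd_same h i x : upd h i x i = x.
Proof. by rewrite /upd eqxx. Qed.

Lemma upd_other h i x j : j != i -> upd h i x j = h j.
Proof. by rewrite /upd => /negbTE->. Qed.

Lemma eq_nc_word N k h1 h2 :
  (forall j, j < N -> h1 j = h2 j) -> nc_word N k h1 -> nc_word N k h2.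
Proof.
move=> e [lt_h surj_h rg_h nc_h]; split.
- by move=> j jN; rewrite -e //; apply: lt_h.
- by move=> v /surj_h[i iN <-]; exists i; rewrite ?e.
- move=> j v jN; rewrite -e // => /(rg_h _ _ jN)[i ij <-].
  by exists i; rewrite // e //; lia.
- move=> a b c d ab bc cd dN; rewrite -!e; try lia.
  exact: nc_h.
Qed.

(** Positions carrying distinct letters have distinct images, so weak monotonicity is strict along a
    crossing and carries it to a crossing of [h]. *)
Lemma nc_word_reindex N k h (phi : nat -> nat) :
    nc_word N k h ->
    (forall i j, i <= j -> phi i <= phi j) ->
    (forall i, i < N -> phi i < N) ->
    (forall v, v < k -> exists2 i, i < N & h (phi i) = v) ->
    (forall j v, j < N -> v < h (phi j) -> exists2 i, i < j & h (phi i) = v) ->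
  nc_word N k (h \o phi).
Proof.
move=> [lt_h surj_h rg_h nc_h] mono bnd surj rg; split=> //.
  by move=> j /bnd /lt_h.
move=> a b c d ab bc cd dN /= eac ebd.
case: (h (phi a) =P h (phi b)) => // neq.
have lt x y : x < y -> h (phi x) <> h (phi y) -> phi x < phi y.
  move=> /ltnW /mono; rewrite leq_eqVlt => /orP[/eqP->|] //.
apply: (nc_h _ _ (phi c) (phi d)) => //; try exact: bnd.
all: by apply: lt => // e; apply: neq; congruence.
Qed.

(** The new word is [h] read along the map sending [i] to [i.+1]; the letter erased at [i] survives
    at [i.-1]. *)
Lemma nc_word_copy_right N k h i :
    nc_word N k h -> 0 < i -> i.+1 < N -> h i = h i.-1 ->
  nc_word N k (upd h i (h i.+1)).
Proof.
move=> wh i0 iN e.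
pose phi j := if j == i then i.+1 else j.
apply: (@eq_nc_word _ _ (h \o phi)).
  by move=> j _; rewrite /upd /phi /=; case: eqP.
apply: nc_word_reindex => //.
- move=> a b; rewrite /phi; case: eqP; case: eqP; lia.
- move=> a; rewrite /phi; case: eqP; lia.
- move=> v /(nc_word_surj wh)[j jN <-]; case: (j =P i) => [->|/eqP ji].
    exists i.-1; first lia.
    by rewrite /phi ifN ?e //; lia.
  by exists j; rewrite // /phi ifN.
- move=> j v jN lv.
  have [m mj <-] : exists2 m, m < phi j & h m = v.
    by apply: (nc_word_growth wh) => //; rewrite /phi; case: eqP => _; lia.
  have: m < j \/ m = i /\ j = i.
    by move: mj; rewrite /phi; case: eqP; lia.
  case: (m =P i) => [->|/eqP mi] H.
    exists i.-1; first lia.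
    by rewrite /phi ifN ?e //; lia.
  by exists m; [lia | rewrite /phi ifN].
Qed.

Lemma nc_word_copy_left N k h i :
    nc_word N k h -> 0 < i -> i.+1 < N -> h i = h i.+1 ->
  nc_word N k (upd h i (h i.-1)).
Proof.
move=> wh i0 iN e.
pose phi j := if j == i then i.-1 else j.
apply: (@eq_nc_word _ _ (h \o phi)).
  by move=> j _; rewrite /upd /phi /=; case: eqP.
apply: nc_word_reindex => //.
- move=> a b; rewrite /phi; case: eqP; case: eqP; lia.
- move=> a; rewrite /phi; case: eqP; lia.
- move=> v /(nc_word_surj wh)[j jN <-]; case: (j =P i) => [->|/eqP ji].
    exists i.+1; first lia.
    by rewrite /phi ifN ?e //; lia.
  by exists j; rewrite // /phi ifN.
- move=> j v jN lv.
  have [m mj ev] : exists2 m, m < phi j & h m = v.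
    by apply: (nc_word_growth wh) => //; rewrite /phi; case: eqP => _; lia.
  have mj' : m < j by move: mj; rewrite /phi; case: eqP; lia.
  case: (m =P i) => [em|/eqP mi]; last first.
    by exists m; rewrite // /phi ifN.
  exists i.+1; last by rewrite /phi ifN -?e -?em //; lia.
  (* The case [j = i.+1] is impossible: the letter there would be [h i = v], while [v] lies strictly
     below it. *)
  rewrite ltn_neqAle -em mj' andbT; apply/eqP => ej.
  by move: lv; rewrite /phi ifN; rewrite -?ej ?em -?e; [rewrite -em ev ltnn|lia].
Qed.

(** * Cyclic order and a single whirl *)

(* [x] is met strictly before [b] when counting up cyclically from [a]; for
   [a = b] this is a full turn. *)
Definition cyc_between (a x b : nat) : bool :=
  [|| a < x < b, x < b <= a | b <= a < x].

Lemma cyc_between_total a b x :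
  a != b -> cyc_between a b x || cyc_between b a x.
Proof. by rewrite /cyc_between; lia. Qed.

Lemma nc_word_crossing N k h a b c d :
    nc_word N k h -> a < b -> b < c -> c < d -> d < N ->
  h a = h c -> h b = h d -> h a != h b -> False.
Proof.
by move=> wh ab bc cd dN eac ebd /eqP[]; apply: (nc_word_nc wh) eac ebd.
Qed.

(** A value [x] met too early creates a crossing in the updated word: [x] alternates either with
    [h i], which survives at [i.-1], or with [h i.+1]. *)
Lemma next_after_repeat N k h i x :
    nc_word N k h -> 0 < i -> i.+1 < N -> h i = h i.-1 ->
    nc_word N k (upd h i x) -> ~~ cyc_between (h i) x (h i.+1).
Proof.
move=> wh i0 iN e wx; apply/negP => cyc.
have iN' : i < N by lia.
have xk : x < k by rewrite -(upd_same h i x); apply: (nc_word_lt wx).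
(* An earlier [x] above [h i] follows some [h i], which gives the pattern [h i, x, h i, x] ending at
   [i.-1] and [i]. *)
have old_x m : m < i -> h m = x -> h i < x -> False.
  move=> mi em lt_x.
  have mp : m != i.-1 by apply/eqP => emp; subst m; lia.
  have [l lm el] : exists2 l, l < m & h l = h i.
    by apply: (nc_word_growth wh); lia.
  by apply: (@nc_word_crossing _ _ _ l m i.-1 i wx); rewrite ?upd_same ?upd_other; lia.
have old_next : h i.+1 <= h i -> exists2 m, m <= i.-1 & h m = h i.+1.
  rewrite leq_eqVlt => /orP[/eqP ->|]; first by exists i.-1.
  rewrite {1}e => /(nc_word_growth wh) [|m mi em]; first lia.
  by exists m; [lia|].
case/or3P: cyc => /andP[c1 c2].
- have [m mi em] : exists2 m, m < i.+1 & h m = x.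
    exact: (nc_word_growth wh).
  have nm : m != i by apply/eqP => emi; subst m; lia.
  by apply: (old_x m) => //; lia.
- have [m mi em] := old_next c2.
  have [l lm el] : exists2 l, l < m & h l = x.
    by apply: (nc_word_growth wh); lia.
  by apply: (@nc_word_crossing _ _ _ l m i i.+1 wx); rewrite ?upd_same ?upd_other; lia.
- have [m mi em] := old_next c1.
  have [l lN el] := nc_word_surj wh xk.
  have l1 : l != i by apply/eqP => eli; subst l; lia.
  have l2 : l != i.+1 by apply/eqP => eli; subst l; lia.
  case: (ltnP l i) => li; first exact: (old_x l).
  by apply: (@nc_word_crossing _ _ _ m i i.+1 l wx); rewrite ?upd_same ?upd_other; lia.
Qed.

(** The updated word must retain the erased letter [h i] somewhere. Comparing that occurrence with
    [i], and [h i.-1] with [h i], exhibits a crossing in [h] whenever [h i.-1] is not met in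
    time. *)
Lemma left_before_next N k h i y :
    nc_word N k h -> nc_word N k (upd h i y) -> 0 < i -> i.+1 < N ->
    h i != h i.-1 -> y = h i.+1 -> cyc_between (h i) (h i.-1) y.
Proof.
move=> wh wg i0 iN ne ey.
have iN' : i < N by lia.
have ik : h i < k by apply: (nc_word_lt wh).
apply/negPn/negP => ncyc.
have neq : h i != h i.+1.
  by apply/eqP => e; move: ncyc; rewrite /cyc_between; lia.
(* The retained [h i] comes from growth, hence before [i], when it is below the new letter;
   otherwise from surjectivity, possibly after [i]. *)
have [d [dN dlate] ed] :
    exists2 d, d < N /\ (d < i \/ h i.+1 < h i) & upd h i y d = h i.
  have [lt_i|ge_i] := ltnP (h i.+1) (h i).
    by have [d dN ed] := nc_word_surj wg ik; exists d; auto.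
  have [||d di ed] := nc_word_growth wg (j := i) (v := h i) => //.
    by rewrite upd_same; lia.
  by exists d; [split; [lia|left]|].
have di : d != i by apply/eqP => e; subst d; move: ed; rewrite upd_same; lia.
rewrite upd_other // in ed.
have d1 : d != i.+1 by apply/eqP => e; subst d; lia.
have d2 : d != i.-1 by apply/eqP => e; subst d; lia.
have [dlt|dgt] := ltnP d i; last first.
  have [m mi em] : exists2 m, m < i & h m = h i.+1.
    by apply: (nc_word_growth wh); lia.
  by apply: (@nc_word_crossing _ _ _ m i i.+1 d wh); lia.
have [lt_d|ge_d] := ltnP (h i.-1) (h i).
  have [m mi em] : exists2 m, m < d & h m = h i.-1.
    by apply: (nc_word_growth wh); lia.
  by apply: (@nc_word_crossing _ _ _ m d i.-1 i wh); lia.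
have [lt1 lt2] : h i < h i.+1 /\ h i.+1 <= h i.-1.
  by move: ncyc; rewrite /cyc_between; lia.
have [m mi em] : exists2 m, m <= i.-1 & h m = h i.+1.
  move: lt2; rewrite leq_eqVlt => /orP[/eqP ->|]; first by exists i.-1.
  move=> /(nc_word_growth wh) [|m mi em]; first lia.
  by exists m; lia.
have [l lm el] : exists2 l, l < m & h l = h i.
  by apply: (nc_word_growth wh); lia.
by apply: (@nc_word_crossing _ _ _ l m i i.+1 wh); lia.
Qed.

(* The last hypothesis says that [y] is the first admissible value met when
   counting up cyclically from [h i]. *)
Lemma whirl_step N k h i y :
    nc_word N k h -> nc_word N k (upd h i y) -> 0 < i -> i.+1 < N ->
    (forall x, nc_word N k (upd h i x) -> ~~ cyc_between (h i) x y) ->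
  (y == h i.+1) = (h i == h i.-1).
Proof.
move=> wh wy i0 iN first_y; apply/eqP/eqP => e.
  apply/eqP/negPn/negP => ne.
  (* The updated word repeats its letter at [i] and [i.+1], so [h i.-1] may be copied to [i], yet it
     would be met before [y]. *)
  have cyc := left_before_next wh wy i0 iN ne e.
  have wx : nc_word N k (upd h i (h i.-1)).
    have /(nc_word_copy_left wy i0 iN) :
      upd h i y i = upd h i y i.+1 by rewrite upd_same upd_other //; lia.
    apply: eq_nc_word => j _; rewrite /upd; case: eqP => // _.
    by rewrite ifN //; lia.
  by have := first_y _ wx; rewrite cyc.
(* Neither of [y] and [h i.+1] is met strictly before the other, so they agree. *)
have := first_y _ (nc_word_copy_right wh i0 iN e).
have := next_after_repeat wh i0 iN e wy.
by rewrite /cyc_between; lia.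
Qed.

(** * Appending a final letter *)

Lemma nc_word_first N k h : nc_word N k h -> 0 < N -> h 0 = 0.
Proof.
move=> wh N0; case: (posnP (h 0)) => // /(nc_word_growth wh N0)[i].
by rewrite ltn0.
Qed.

(* The first block is never closed off, so a final letter 0 may be appended. *)
Lemma nc_word_append0 N k h :
  0 < N -> h N = 0 -> nc_word N.+1 k h <-> nc_word N k h.
Proof.
move=> N0 hN; split=> wh; have h0 := nc_word_first wh.
  split.
  - by move=> j jN; apply: (nc_word_lt wh); lia.
  - move=> v /(nc_word_surj wh)[i iN <-]; case: (i =P N) => [->|/eqP ne].
      by exists 0; rewrite // hN; apply: h0.
    by exists i => //; lia.
  - by move=> j v jN; apply: (nc_word_growth wh); lia.
  - by move=> a b c d ab bc cd dN; apply: (nc_word_nc wh) => //; apply: ltnW.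
split.
- move=> j; rewrite ltnS leq_eqVlt => /orP[/eqP->|]; last exact: nc_word_lt.
  by rewrite hN -h0 //; apply: (nc_word_lt wh).
- by move=> v /(nc_word_surj wh)[i iN <-]; exists i; lia.
- move=> j v; rewrite ltnS leq_eqVlt => /orP[/eqP->|]; first by rewrite hN.
  exact: (nc_word_growth wh).
- move=> a b c d ab bc cd dN eac ebd; move: dN.
  rewrite ltnS leq_eqVlt => /orP[/eqP ed|dN]; last first.
    exact: (nc_word_nc wh ab bc cd).
  (* For [a > 0], a crossing at [a, b, c, N] becomes one at [0, a, b, c], since
     [h b = h N = h 0]. *)
  subst d; case: (posnP a) => [->|a0]; first by rewrite ebd hN h0.
  have e0b : h 0 = h b by rewrite ebd hN h0.
  by rewrite -e0b; apply/esym/(nc_word_nc wh a0 ab bc).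
Qed.

(** * Whirling of finite functions *)

Section FiniteWords.

Variables n k : nat.
Implicit Types (f g : {ffun 'I_n -> 'I_k}) (F : {set {ffun 'I_n -> 'I_k}}).

(** The default [0], taken at position [n], is the appended letter. *)
Definition ext f (j : nat) : nat := oapp (fun i => f i : nat) 0 (insub j).

Lemma extE f (i : 'I_n) : ext f i = f i.
Proof. by rewrite /ext valK. Qed.

Lemma ext_end f : ext f n = 0.
Proof. by rewrite /ext insubF // ltnn. Qed.

Definition set_at f (i : 'I_n) (x : 'I_k) : {ffun 'I_n -> 'I_k} :=
  [ffun j => if j == i then x else f j].

Lemma ext_set_at f i x : ext (set_at f i x) =1 upd (ext f) i x.
Proof.
move=> j; rewrite /upd /ext; case: insubP => [u _ <- /=|nj /=].
  by rewrite ffunE val_eqE; case: eqP => // _; rewrite valK.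
by case: eqP => // e; move: nj; rewrite e ltn_ord.
Qed.

Lemma iter_incr_at i f t :
  iter t (incr_at i) f = set_at f i (iter t (@ordS k) (f i)).
Proof.
elim: t => [|t IHt]; apply/ffunP => j; rewrite ?iterS ?IHt !ffunE.
  by case: eqP => // ->.
by case: eqP.
Qed.

Lemma iter_ordS (x : 'I_k) t : iter t (@ordS k) x = (x + t) %% k :> nat.
Proof.
elim: t => [|t IHt]; first by rewrite addn0 modn_small.
by rewrite iterS /= IHt addnS -[in LHS]addn1 modnDml addn1.
Qed.

(** Replaces the search by its outcome: the first admissible value in cyclic order, a return to
    [f i] counting as a full turn. *)
Variant whirl_at_spec F i f : {ffun 'I_n -> 'I_k} -> Prop :=
  WhirlAtSpec x of set_at f i x \in F
    & (forall y, set_at f i y \in F -> ~~ cyc_between (f i) y x) :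
    whirl_at_spec F i f (set_at f i x).

Lemma whirl_atP F i f : f \in F -> whirl_at_spec F i f (whirl_at F i f).
Proof.
move=> fF; have k0 : 0 < k by apply: leq_ltn_trans (ltn_ord (f i)).
(* A full turn restores [f], so the search always succeeds. *)
have fE : iter k (incr_at i) f = f.
  rewrite iter_incr_at; apply/ffunP => j; rewrite ffunE; case: eqP => // ->.
  by apply/val_inj; rewrite /= iter_ordS modnDr modn_small.
pose s := traject (incr_at i) (incr_at i f) k.
have has_s : has (mem F) s.
  apply/hasP; exists f => //; apply/trajectP; exists k.-1; first by lia.
  by rewrite -iterSr prednK.
have nthE r : r < k -> nth f s r = iter r.+1 (incr_at i) f.
  by move=> rk; rewrite (set_nth_default (incr_at i f)) ?size_traject // nth_traject // -iterSr.
have find_lt : find (mem F) s < k by rewrite has_find size_traject in has_s.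
(* The successor accounts for the list starting after one increment. *)
pose t := (find (mem F) s).+1.
have t_in : iter t (incr_at i) f \in F.
  have := nth_find f has_s; by rewrite nthE.
have t_first r : 0 < r -> r < t -> iter r (incr_at i) f \notin F.
  case: r => // r _ lt_r; have /(before_find f) : r < find (mem F) s by [].
  by rewrite nthE; [move=> /= -> | lia].
have -> : whirl_at F i f = iter t (incr_at i) f.
  rewrite /whirl_at -/s.
  have headE : forall (x0 : {ffun 'I_n -> 'I_k}) r, has (mem F) r ->
      head x0 [seq g <- r | g \in F] = nth x0 r (find (mem F) r).
    by move=> x0; elim=> //= x r IHr; case: ifP.
  by rewrite headE // nthE.
rewrite iter_incr_at in t_in *.
constructor=> // y yF; apply/negP => cyc.
(* The number of increments from [f i] to [y], between 1 and [k]; reaching [y = f i] costs [k]. *)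
pose r := if (f i : nat) < y then y - f i else y + k - f i.
have yE : iter r (@ordS k) (f i) = y.
  apply/val_inj; rewrite /= iter_ordS /r.
  have := ltn_ord y; have := ltn_ord (f i); case: ifP => c ? ?.
    by rewrite subnKC ?modn_small // ltnW.
  by rewrite subnKC ?modnDr ?modn_small //; lia.
have t_le : t <= k by [].
have [r0 rt] : 0 < r /\ r < t.
  move: cyc; rewrite /cyc_between iter_ordS /r.
  have := ltn_ord y; have := ltn_ord (f i).
  have -> : (f i + t) %% k = if f i + t < k then f i + t else f i + t - k.
    case: ltnP => c; first by rewrite modn_small.
    by rewrite -{1}(subnK c) modnDr modn_small //; have := ltn_ord (f i); lia.
  by case: (ltnP (f i + t) k) => ?; case: (ltnP (f i) y) => ?; lia.
by have := t_first _ r0 rt; rewrite iter_incr_at yE yF.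
Qed.

Lemma whirl_at_mem F i f : f \in F -> whirl_at F i f \in F.
Proof. by case/(@whirl_atP _ i). Qed.

Lemma whirl_at_other F i f j : f \in F -> j != i -> whirl_at F i f j = f j.
Proof. by move=> /(@whirl_atP _ i)[x _ _] ji; rewrite ffunE (negbTE ji). Qed.

(** Two preimages agree off [i], so the letter of each at [i] is admissible for the other. If these
    letters differed, one would be met before the common result. *)
Lemma whirl_at_inj F i : {in F &, injective (whirl_at F i)}.
Proof.
move=> f g fF gF e.
have off j : j != i -> f j = g j.
  by move=> ji; rewrite -(whirl_at_other fF ji) e whirl_at_other.
have set_fg : set_at f i =1 set_at g i.
  by move=> x; apply/ffunP => j; rewrite !ffunE; case: eqP => // /eqP /off.
have set_id h : set_at h i (h i) = h.
  by apply/ffunP => j; rewrite ffunE; case: eqP => // ->.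
suff ei : f i = g i by apply/ffunP => j; have [->|/off] := eqVneq j i.
move: e; case: (whirl_atP i fF) => x _ firstx.
case: (whirl_atP i gF) => y _ firsty.
move=> /ffunP /(_ i); rewrite !ffunE eqxx => exy; subst y.
apply/ord_inj/eqP/negPn/negP => /(@cyc_between_total _ _ x) /orP[] cyc.
  by have := firstx (g i); rewrite set_fg set_id gF cyc => /(_ isT).
by have := firsty (f i); rewrite -set_fg set_id fF cyc => /(_ isT).
Qed.

Lemma whirl_foldl_mem F r f :
  f \in F -> foldl (fun g i => whirl_at F i g) f r \in F.
Proof. by elim: r f => //= i r IHr f fF; apply/IHr/whirl_at_mem. Qed.

Lemma whirl_mem F f : f \in F -> whirl F f \in F.
Proof. exact: whirl_foldl_mem. Qed.

Lemma whirl_inj F : {in F &, injective (whirl F)}.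
Proof.
rewrite /whirl; elim: (enum _) => [|i r IHr] f g fF gF //= e.
by apply: (@whirl_at_inj F i) => //; apply: IHr => //; apply: whirl_at_mem.
Qed.

End FiniteWords.

(** * RG-words of noncrossing partitions *)

Section RestrictedGrowth.

Variables n k : nat.
Implicit Types (f : {ffun 'I_n -> 'I_k}) (B : {set 'I_n}).

Lemma least_le B i : i \in B -> least B <= i.
Proof.
rewrite /least -big_filter => iB.
have : i \in [seq j <- index_enum 'I_n | j \in B].
  by rewrite mem_filter iB mem_index_enum.
elim: [seq _ <- _ | _] => //= j s IHs; rewrite big_cons inE geq_min.
by case/orP => [/eqP->|/IHs ->]; rewrite ?leqnn ?orbT.
Qed.

Lemma least_mem B : B != set0 -> exists2 i, i \in B & least B = i.
Proof.
case/set0Pn => i iB; have lt_n := leq_ltn_trans (least_le iB) (ltn_ord i).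
have : least B = n \/ exists2 i, i \in B & least B = i.
  rewrite /least; elim/big_ind: _ => [|x y xP yP|j jB]; first by left.
    by rewrite /minn; case: ifP.
  by right; exists j.
by case=> // e; rewrite e ltnn in lt_n.
Qed.

Lemma RGnc_nc_word f : f \in RGnc n k -> nc_word n k (ext f).
Proof.
rewrite inE => /existsP[P /and4P[partP /eqP cardP ncP /forallP fP]].
have [/eqP covP trivP ne0] := and3P partP.
pose bl := blocks P.
have perm_bl : perm_eq bl (enum P) by rewrite perm_sort.
have size_bl : size bl = k by rewrite (perm_size perm_bl) -cardE.
have mem_bl B : (B \in bl) = (B \in P) by rewrite (perm_mem perm_bl) mem_enum.
have uniq_bl : uniq bl by rewrite (perm_uniq perm_bl) enum_uniq.
have in_block i : i \in pblock P i by rewrite mem_pblock covP inE.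
have block_in i : pblock P i \in P by rewrite pblock_mem // covP inE.
have fE i : f i = index (pblock P i) bl :> nat by apply/eqP/fP.
have same i j : f i = f j :> nat -> pblock P i = pblock P j.
  rewrite !fE => e; rewrite -(nth_index set0 (s := bl) (x := pblock P i)).
    by rewrite e nth_index // mem_bl.
  by rewrite mem_bl.
have nthP v : v < k -> nth set0 bl v \in P.
  by move=> vk; rewrite -mem_bl mem_nth // size_bl.
have fnth v i : v < k -> i \in nth set0 bl v -> f i = v :> nat.
  move=> vk iB; rewrite fE (def_pblock trivP _ iB) ?nthP //.
  by rewrite index_uniq // size_bl.
split.
- by move=> j jn; rewrite (extE f (Ordinal jn)).
- move=> v vk; have [|i iB _] := @least_mem (nth set0 bl v).
    by apply: contraNneq ne0 => <-; apply: nthP.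
  by exists i; rewrite // extE; apply: fnth.
- move=> j v jn; rewrite (extE f (Ordinal jn)); set o := Ordinal jn => lt_v.
  have vk : v < k by apply: ltn_trans lt_v _.
  (* The least element of block [v] is the witness: block [v] precedes the block of [j] in the order
     by least elements. *)
  have [|i iB li] := @least_mem (nth set0 bl v).
    by apply: contraNneq ne0 => <-; apply: nthP.
  have fi := fnth _ _ vk iB.
  exists i; last by rewrite extE.
  have le_ij : i <= j.
    rewrite -li; apply: leq_trans (least_le (in_block o)).
    have -> : pblock P o = nth set0 bl (f o).
      by rewrite fE nth_index // mem_bl.
    have tr : transitive (fun A B : {set 'I_n} => least A <= least B).
      by move=> ? ? ?; apply: leq_trans.
    apply: (sorted_leq_nth tr) => //; rewrite ?inE ?size_bl ?(ltnW lt_v) //.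
      by apply: sort_sorted => A B; apply: leq_total.
  rewrite ltn_neqAle le_ij andbT; apply/eqP => e.
  have eio : i = o by apply/ord_inj.
  by rewrite -eio fi ltnn in lt_v.
- move=> a b c d ab bc cd dn.
  have cn := ltn_trans cd dn; have bn := ltn_trans bc cn.
  have an := ltn_trans ab bn.
  rewrite (extE f (Ordinal an)) (extE f (Ordinal bn)) (extE f (Ordinal cn)).
  rewrite (extE f (Ordinal dn)) => eac ebd.
  apply/eqP/negPn/negP => ne.
  have neB : pblock P (Ordinal an) != pblock P (Ordinal bn).
    by apply: contraNneq ne => e; rewrite !fE e.
  move/forall_inP: ncP => /(_ _ (block_in (Ordinal an))).
  move=> /forall_inP/(_ _ (block_in (Ordinal bn))).
  rewrite neB => /negP; apply.
  apply/exists_inP; exists (Ordinal an) => //.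
  apply/exists_inP; exists (Ordinal bn) => //.
  apply/exists_inP; exists (Ordinal cn); first by rewrite (same _ _ eac).
  apply/exists_inP; exists (Ordinal dn); first by rewrite (same _ _ ebd).
  by rewrite ab bc cd.
Qed.

(** The partition consists of the fibers. By growth, listing them by value already sorts them by
    least element, so ranks in [blocks] are the letters. *)
Lemma nc_word_RGnc f : nc_word n k (ext f) -> f \in RGnc n k.
Proof.
move=> wf; pose fiber (v : 'I_k) := [set j | f j == v].
pose s := [seq fiber v | v <- enum 'I_k].
pose P := [set B in s].
have memP B : (B \in P) = (B \in s) by rewrite inE.
have fiberP v : fiber v \in P by rewrite memP map_f // mem_enum.
have inP B : B \in P -> exists v, B = fiber v.
  by rewrite memP => /mapP[v _ ->]; exists v.
have fiber_ne v : exists i, f i = v.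
  have [i iN ei] := nc_word_surj wf (ltn_ord v).
  exists (Ordinal iN); apply/ord_inj; rewrite -ei.
  exact: (esym (extE f (Ordinal iN))).
have mem_fiber v i : (i \in fiber v) = (f i == v) by rewrite inE.
have fiber_inj : injective fiber.
  move=> v w e; have [i ei] := fiber_ne v.
  by have := mem_fiber v i; rewrite e mem_fiber ei eqxx => /eqP.
have uniq_s : uniq s by rewrite map_inj_uniq // enum_uniq.
have size_s : size s = k by rewrite size_map size_enum_ord.
have partP : partition P [set: 'I_n].
  apply/and3P; split.
  - rewrite eqEsubset subsetT; apply/subsetP => i _.
    by apply/bigcupP; exists (fiber (f i)); rewrite // mem_fiber.
  - apply/trivIsetP => _ _ /inP[v ->] /inP[w ->] ne.
    rewrite -setI_eq0; apply/eqP/setP => i; rewrite !inE.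
    by apply/negP => /andP[/eqP-> /eqP e]; rewrite e eqxx in ne.
  - apply/negP => /inP[v e]; have [i ei] := fiber_ne v.
    by have := mem_fiber v i; rewrite -e inE ei eqxx.
have [_ trivP _] := and3P partP.
have blockE i : pblock P i = fiber (f i).
  by apply: (def_pblock trivP); rewrite // mem_fiber.
have blocksE : blocks P = s.
  have perm_s : perm_eq (blocks P) s.
    rewrite perm_sort; apply: uniq_perm; rewrite ?enum_uniq // => B.
    by rewrite mem_enum memP.
  apply: (@sorted_eq_in _ (fun A B : {set 'I_n} => least A <= least B)) => //.
  - by move=> ? ? ? _ _ _; apply: leq_trans.
  (* Fibers with equal least elements coincide, so the order is antisymmetric on blocks and the
     sorted list is unique. *)
  - move=> B C; rewrite !(perm_mem perm_s) -!memP => /inP[v ->] /inP[w ->].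
    rewrite -eqn_leq => /eqP e.
    have ne u : fiber u != set0.
      by have [i ei] := fiber_ne u; apply/set0Pn; exists i; rewrite mem_fiber ei.
    have [i iv li] := least_mem (ne v); have [j jw lj] := least_mem (ne w).
    move: iv jw; rewrite !mem_fiber => /eqP <- /eqP <-.
    by congr (fiber (f _)); apply/ord_inj; rewrite -li -lj.
  - by apply: sort_sorted => A B; apply: leq_total.
  - rewrite sorted_map.
    apply: (@sub_sorted _ (relpre (@nat_of_ord k) ltn)); last first.
      by rewrite -sorted_map val_enum_ord iota_ltn_sorted.
    move=> v w /= lt_vw; have [j ej] := fiber_ne w.
    have jw : j \in fiber w by rewrite mem_fiber ej.
    have [j' j'w lj] : exists2 j', j' \in fiber w & least (fiber w) = j'.
      by apply: least_mem; apply/set0Pn; exists j.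
    rewrite lj.
    (* Growth at the least position carrying [w] supplies an earlier [v]. *)
    have [||i ij ei] := nc_word_growth wf (j := j') (v := v) => //.
      by rewrite extE; move: j'w; rewrite mem_fiber => /eqP->.
    have iN := ltn_trans ij (ltn_ord j').
    apply: leq_trans (ltnW ij); apply: (@least_le _ (Ordinal iN)).
    by rewrite mem_fiber; apply/eqP/ord_inj; rewrite -ei (extE f (Ordinal iN)).
rewrite inE; apply/existsP; exists P; apply/and4P; split=> //.
- by rewrite cardsE (card_uniqP uniq_s) size_s.
- apply/forall_inP => _ /inP[v ->]; apply/forall_inP => _ /inP[w ->].
  apply/implyP => ne; apply/negP => /exists_inP[a av /exists_inP[b bw]].
  case/exists_inP => c cv /exists_inP[d dw /and3P[ab bc cd]].
  move: av bw cv dw; rewrite !mem_fiber => /eqP ea /eqP eb /eqP ec /eqP ed.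
  have := nc_word_nc wf ab bc cd (ltn_ord d).
  rewrite !extE ea eb ec ed => /(_ erefl erefl) /ord_inj e.
  by rewrite e eqxx in ne.
- apply/forallP => i; rewrite /rg_word blockE blocksE index_map //.
  by rewrite index_enum_ord.
Qed.

End RestrictedGrowth.

(** * The two indicators along an orbit *)

Lemma whirl_second_last n k (hn : 2 <= n) (f : {ffun 'I_n -> 'I_k}) :
  f \in RGnc n k ->
  ((whirl (RGnc n k) f (pos_last hn) : nat) == 0) =
  ((f (pos_second hn) : nat) == 0).
Proof.
move=> fF; set F := RGnc n k in fF *.
pose g m := foldl (fun g i => whirl_at F i g) f (take m (enum 'I_n)).
have gF m : g m \in F by apply: whirl_foldl_mem.
have gS (i : 'I_n) : g i.+1 = whirl_at F i (g i).
  by rewrite /g (take_nth i) ?size_enum_ord // nth_ord_enum foldl_rcons.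
have word h : h \in F -> nc_word n.+1 k (ext h).
  by move/RGnc_nc_word => ?; apply/nc_word_append0; rewrite ?ext_end //; lia.
have ext0 h : h \in F -> ext h 0 = 0 by move/word/nc_word_first; apply.
(* After [m] whirls, position [m.-1] has just been treated and [m] is untouched. The comparison is
   with the forced initial [0] at [m = 1] and with the appended [0] at [m = n]. *)
have ladder m : 0 < m <= n ->
    (ext (g m) m == ext (g m) m.-1) = ((f (pos_second hn) : nat) == 0).
  case/andP; elim: m => [//|m IHm] _ mn; pose i := Ordinal mn.
  have [em|m0] := posnP m.
    subst m; rewrite -[0.+1.-1]/0 ext0 // (gS i) /g take0 /=.
    by rewrite (extE _ (pos_second hn)) whirl_at_other.
  rewrite -(IHm m0 (ltnW mn)) (gS i) /=.
  case: (whirl_atP i (gF m)) => x xF first_x.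
  have -> : ext (set_at (g m) i x) m.+1 = ext (g m) m.+1.
    by rewrite ext_set_at upd_other //=; lia.
  rewrite (extE _ i) ffunE eqxx eq_sym.
  have wx := word _ xF.
  apply: (@whirl_step n.+1 k) => //; first exact: word.
    by apply: eq_nc_word wx => j _; rewrite ext_set_at.
  (* Here [y] is any natural number; admissibility bounds it by [k] and makes it an ordinal. *)
  move=> y wy; have yk : y < k.
    by rewrite -(upd_same (ext (g m)) m y); apply: (nc_word_lt wy); lia.
  rewrite (extE _ i); apply: (first_x (Ordinal yk)).
  apply: nc_word_RGnc.
  have n0 : 0 < n by lia.
  apply/(nc_word_append0 k n0 (ext_end _)).
  by apply: eq_nc_word wy => j _; rewrite ext_set_at.
have <- := ladder n; last by lia.
rewrite ext_end eq_sym -extE /= subn1.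
by rewrite /g take_oversize // size_enum_ord.
Qed.

(** Injectivity on [F] makes [w] permute the finite orbit, so summing [s2] after [w] only reorders
    the terms. *)
Lemma sum_orbit_shift (T : finType) (F : {set T}) (w : T -> T)
    (s1 s2 : T -> rat) x :
    (forall y, y \in F -> w y \in F) -> {in F &, injective w} ->
    (forall y, y \in F -> s2 (w y) = s1 y) -> x \in F ->
  (\sum_(y <- orbit w x) s1 y = \sum_(y <- orbit w x) s2 y)%R.
Proof.
move=> wF injw s12 xF.
have orbF y : y \in orbit w x -> y \in F.
  by case/trajectP => m _ ->; elim: m => //= m; apply: wF.
have uniq_w : uniq (map w (orbit w x)).
  rewrite map_inj_in_uniq ?orbit_uniq // => y z /orbF yF /orbF zF.
  exact: injw.
have perm_w : perm_eq (map w (orbit w x)) (orbit w x).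
  apply: uniq_perm; rewrite ?orbit_uniq //.
  apply: (uniq_min_size uniq_w _ _).2; last by rewrite size_map.
  move=> _ /mapP[y + ->]; rewrite -!fconnect_orbit => /connect_trans; apply.
  exact: fconnect1.
apply/esym; rewrite -(perm_big _ perm_w) /= big_map; apply: eq_big_seq => y /orbF yF.
by rewrite s12.
Qed.

Theorem theorem3p18 (n k : nat) (hn : 2 <= n) (hk : 1 <= k <= n) :
  mesic (RGnc n k) (whirl (RGnc n k))
    (fun f => (indic1 (pos_second hn) f - indic1 (pos_last hn) f)%R) 0%R.
Proof.
move=> f fF; rewrite GRing.sumrB.
have injw := @whirl_inj n k (RGnc n k).
rewrite (@sum_orbit_shift _ _ _ _ (indic1 (pos_last hn)) _ _ injw _ fF).
- by rewrite GRing.subrr GRing.mulr0.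
- exact: whirl_mem.
- by move=> g gF; rewrite /indic1 whirl_second_last.
Qed.
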